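(* Let $n_1,n_2,n_3$ be positive integers, let $\Omega\subseteq[n_1]\times[n_2]\times[n_3]$, and let real numbers $\mathcal{A}_{ijk}$ be given for $(i,j,k)\in\Omega$. Let $f(a,b)$ be the associated biquadratic polynomial defined in the context, and consider the biquadratic optimization problem $$(\mathrm{P})\qquad \min\ f(a,b)\quad\text{subject to}\quad\|a\|^2=\|b\|^2=1,\quad a\in\mathbb{R}^{n_1},\ b\in\mathbb{R}^{n_2},$$ and its convex relaxation $$(\mathrm{R})\qquad \min_{y\in\mathbb{R}^\Gamma}\ \langle f,y\rangle\quad\text{subject to}\quad \mathrm{Trace}\,G[y]=1,\quad G[y]\succeq0.$$ Suppose $y^*$ is a minimizer of $(\mathrm{R})$ and that $$G[y^*]=\sum_{i=1}^r\lambda_i\,\big(a^{(i)}(a^{(i)})^T\big)\otimes\big(b^{(i)}(b^{(i)})^T\big)$$ for some vectors $a^{(i)}\in\mathbb{R}^{n_1}$, $b^{(i)}\in\mathbb{R}^{n_2}$ with $\|a^{(i)}\|=\|b^{(i)}\|=1$ and scalars $\lambda_i>0$, $i=1,\dots,r$. Then each pair $(a^{(i)},b^{(i)})$, $i=1,\dots,r$, is a minimizer of $(\mathrm{P})$.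
   Context: For a positive integer $n$, $[n]=\{1,\dots,n\}$; $\|\cdot\|$ is the Euclidean norm; $\otimes$ is the Kronecker product of matrices; $M\succeq0$ means the symmetric matrix $M$ is positive semidefinite. For each $k\in[n_3]$, let $\Omega_k=\{(i,j)\in[n_1]\times[n_2]:(i,j,k)\in\Omega\}$, $m_k=|\Omega_k|$, and enumerate $\Omega_k=\{(i_1,j_1),\dots,(i_{m_k},j_{m_k})\}$ (the enumeration depends on $k$). Define $$f(a,b)=\sum_{k=1}^{n_3}\ \sum_{1\le s<t\le m_k}\left(\mathcal{A}_{i_sj_sk}a_{i_t}b_{j_t}-\mathcal{A}_{i_tj_tk}a_{i_s}b_{j_s}\right)^2 .$$ Let $\Gamma=\{(i,j,k,l):1\le i\le j\le n_1,\ 1\le k\le l\le n_2\}$ and let $\mathbb{R}^\Gamma$ be the space of real vectors $y=(y_{ijkl})$ labelled by $(i,j,k,l)\in\Gamma$. Let $E_{ii}=e_ie_i^T$ and $E_{ij}=e_ie_j^T+e_je_i^T$ for $i\neq j$ ($n_1\times n_1$ matrices), and $E_{kk}=e_ke_k^T$ and $E_{kl}=e_ke_l^T+e_le_k^T$ for $k\ne l$ ($n_2\times n_2$ matrices), where $e_i$ are standard basis vectors. Define the $n_1n_2\times n_1n_2$ symmetric matrix $$G[y]=\sum_{(i,j,k,l)\in\Gamma}y_{ijkl}\,E_{ij}\otimes E_{kl},$$ where $E_{ij}$ is of size $n_1\times n_1$ and $E_{kl}$ of size $n_2\times n_2$. Write uniquely $f(a,b)=\sum_{(i,j,k,l)\in\Gamma}f_{ijkl}a_ia_jb_kb_l$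 and set $\langle f,y\rangle=\sum_{(i,j,k,l)\in\Gamma}f_{ijkl}y_{ijkl}$. *)

(* Defs.v *)
From HB Require Import structures.
From mathcomp Require Import all_boot all_order all_algebra.
From mathcomp Require Import boolp reals ring.
From mathcomp Require Export mxtens.

Set Implicit Arguments.
Unset Strict Implicit.
Unset Printing Implicit Defensive.

Import Order.TTheory GRing.Theory Num.Theory.
Local Open Scope ring_scope.

Definition is_minimizer (R : realType) (T : Type)
    (feasible : T -> Prop) (obj : T -> R) (x : T) : Prop :=
  feasible x /\ forall z, feasible z -> obj x <= obj z.

(* The Euclidean norm; the canonical norm on matrices is the sup norm. *)
Definition enorm (R : realType) (n : nat) (a : 'cV[R]_n) : R :=
  Num.sqrt (\sum_(i < n) a i 0 ^+ 2).

Definition psdmx (R : realType) (n : nat) (M : 'M[R]_n) : Prop :=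
  M^T = M /\ forall x : 'cV[R]_n, 0 <= (x^T *m M *m x) 0 0.

Section Objective.

Variables (R : realType) (n1 n2 n3 : nat).
Variable Omega : {set 'I_n1 * 'I_n2 * 'I_n3}.
(* Only the values of A on Omega matter. *)
Variable A : 'I_n1 -> 'I_n2 -> 'I_n3 -> R.

Definition slice (k : 'I_n3) : {set 'I_n1 * 'I_n2} :=
  [set p | (p.1, p.2, k) \in Omega].

(* The pair (i_s, j_s) in the canonical enumeration of the k-th slice; the
   summands of biquad_obj are symmetric in s and t, so that biquad_obj does not
   depend on the enumeration. *)
Definition slice_nth (k : 'I_n3) (s : 'I_#|slice k|) : 'I_n1 * 'I_n2 :=
  enum_val s.

Definition biquad_obj (a : 'cV[R]_n1) (b : 'cV[R]_n2) : R :=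
  \sum_(k < n3) \sum_(s < #|slice k|) \sum_(t < #|slice k| | (s < t)%N)
    (let: (is_, js) := slice_nth s in
     let: (it, jt) := slice_nth t in
     A is_ js k * a it 0 * b jt 0 - A it jt k * a is_ 0 * b js 0) ^+ 2.

End Objective.

Section Biquadratic.

Variables (R : realType) (n1 n2 : nat).

Definition in_Gamma (p : ('I_n1 * 'I_n1) * ('I_n2 * 'I_n2)) : bool :=
  (p.1.1 <= p.1.2)%N && (p.2.1 <= p.2.2)%N.

Definition Gamma : finType :=
  {p : ('I_n1 * 'I_n1) * ('I_n2 * 'I_n2) | in_Gamma p}.

Definition gi (g : Gamma) : 'I_n1 := (val g).1.1.
Definition gj (g : Gamma) : 'I_n1 := (val g).1.2.
Definition gk (g : Gamma) : 'I_n2 := (val g).2.1.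
Definition gl (g : Gamma) : 'I_n2 := (val g).2.2.

Definition biquad_eval (c : {ffun Gamma -> R})
    (a : 'cV[R]_n1) (b : 'cV[R]_n2) : R :=
  \sum_(g : Gamma) c g * a (gi g) 0 * a (gj g) 0 * b (gk g) 0 * b (gl g) 0.

Lemma gammasumE (F : 'I_n1 -> 'I_n1 -> 'I_n2 -> 'I_n2 -> R) :
  \sum_(g : Gamma) F (gi g) (gj g) (gk g) (gl g) =
  \sum_(k < n2) \sum_(l < n2 | (k <= l)%N)
    \sum_(i < n1) \sum_(j < n1 | (i <= j)%N) F i j k l.
Proof.
have -> : \sum_(g : Gamma) F (gi g) (gj g) (gk g) (gl g) =
    \sum_(p | in_Gamma p) F p.1.1 p.1.2 p.2.1 p.2.2.
  rewrite [RHS](reindex_omap (val : Gamma -> _) insub) => [|p pP].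
    by apply: eq_bigl => g; rewrite (valP g) valK eqxx.
  by rewrite insubT.
rewrite -(pair_big (fun p : 'I_n1 * 'I_n1 => (p.1 <= p.2)%N)
  (fun p : 'I_n2 * 'I_n2 => (p.1 <= p.2)%N)
  (fun p q => F p.1 p.2 q.1 q.2)) /= exchange_big /=.
rewrite (pair_big_dep xpredT (fun k l : 'I_n2 => (k <= l)%N)) /=.
apply: eq_bigr => q _.
by rewrite (pair_big_dep xpredT (fun i j : 'I_n1 => (i <= j)%N)
  (fun i j => F i j q.1 q.2)).
Qed.

Lemma qform_eq0 n (c : 'I_n -> 'I_n -> R) :
  (forall a : 'cV[R]_n,
     \sum_(i < n) \sum_(j < n | (i <= j)%N) c i j * (a i 0 * a j 0) = 0) ->
  forall i j : 'I_n, (i <= j)%N -> c i j = 0.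
Proof.
move=> c0.
pose Q (u v : 'cV[R]_n) :=
  \sum_(i < n) \sum_(j < n | (i <= j)%N) c i j * (u i 0 * v j 0).
have QD u v : Q (u + v) (u + v) = Q u u + Q v v + Q u v + Q v u.
  rewrite /Q -!big_split; apply: eq_bigr => i _.
  rewrite -!big_split; apply: eq_bigr => j _ /=.
  rewrite !mxE; ring.
have Qe (p q : 'I_n) :
    Q (delta_mx p 0) (delta_mx q 0) = if (p <= q)%N then c p q else 0.
  rewrite /Q (bigD1 p) //= [X in _ + X]big1 ?addr0; last first.
    by move=> i /negPf ip; apply: big1 => j _; rewrite !mxE ip mul0r mulr0.
  case: ifP => pq.
    rewrite (bigD1 q) //= big1 ?addr0 ?mxE ?eqxx ?mulr1 //.
    by move=> j /andP[_ /negPf jq]; rewrite !mxE jq !mulr0.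
  apply: big1 => j pj; rewrite !mxE; case: (j =P q) => [jq|_] /=;
    last by rewrite !mulr0.
  by rewrite -jq pj in pq.
have cd p : c p p = 0 by have := Qe p p; rewrite leqnn => <-; exact: c0.
move=> i j; rewrite leq_eqVlt => /orP[/eqP/val_inj ->//|ij].
have /esym := QD (delta_mx i 0) (delta_mx j 0).
rewrite {5}/Q c0 !Qe !leqnn !cd (ltnW ij) leqNgt ij /= !add0r addr0 //.
Qed.

Lemma biquad_eval_inj (c d : {ffun Gamma -> R}) :
  (forall a b, biquad_eval c a b = biquad_eval d a b) -> c = d.
Proof.
move=> cd; apply/ffunP => g0; apply/eqP; rewrite -subr_eq0; apply/eqP.
pose e i j k l : R :=
  if insub ((i, j), (k, l)) is Some g then c g - d g else 0.
have eE (g : Gamma) : e (gi g) (gj g) (gk g) (gl g) = c g - d g.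
  rewrite /e /gi /gj /gk /gl.
  have -> : (((val g).1.1, (val g).1.2), ((val g).2.1, (val g).2.2)) = val g.
    by case: (val g) => [[? ?] [? ?]].
  by rewrite valK.
rewrite -eE.
have /andP[ij kl] : in_Gamma (val g0) := valP g0.
apply: (qform_eq0 (c := fun i j => e i j (gk g0) (gl g0))) => // a.
apply: (qform_eq0 (c := fun k l =>
  \sum_(i < n1) \sum_(j < n1 | (i <= j)%N) e i j k l * (a i 0 * a j 0))) => // b.
have /eqP := cd a b; rewrite -subr_eq0 => /eqP cd0; rewrite -[RHS]cd0.
rewrite /biquad_eval -sumrB.
under [RHS]eq_bigr => g _ do rewrite -!mulrBl -eE.
rewrite (gammasumE (fun i j k l => e i j k l * a i 0 * a j 0 * b k 0 * b l 0)).
apply: eq_bigr => k _; apply: eq_bigr => l _; rewrite mulr_suml.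
apply: eq_bigr => i _; rewrite mulr_suml.
by apply: eq_bigr => j _; rewrite !mulrA.
Qed.

Definition is_biquad (F : 'cV[R]_n1 -> 'cV[R]_n2 -> R) : Prop :=
  exists c, forall a b, F a b = biquad_eval c a b.

Lemma is_biquadD F G :
  is_biquad F -> is_biquad G -> is_biquad (fun a b => F a b + G a b).
Proof.
move=> [c cE] [d dE]; exists [ffun g => c g + d g] => a b.
rewrite cE dE /biquad_eval -big_split; apply: eq_bigr => g _ /=.
by rewrite ffunE !mulrDl.
Qed.

Lemma is_biquad_sum (I : finType) (P : pred I) F :
  (forall i, is_biquad (F i)) ->
  is_biquad (fun a b => \sum_(i | P i) F i a b).
Proof.
move=> HF; elim: (index_enum I) => [|i s [c cE]].
  exists [ffun=> 0] => a b; rewrite big_nil /biquad_eval big1 // => g _.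
  by rewrite ffunE !mul0r.
case Pi : (P i); last by exists c => a b; rewrite big_cons Pi.
have [d dE] := is_biquadD (HF i) (ex_intro _ c cE).
by exists d => a b; rewrite big_cons Pi dE.
Qed.

Lemma is_biquad_monom (x : R) i j k l :
  is_biquad (fun a b => x * a i 0 * a j 0 * b k 0 * b l 0).
Proof.
wlog ij : i j / (i <= j)%N.
  move=> H; case: (leqP i j) => [/H//|/ltnW/H[c cE]].
  by exists c => a b; rewrite -cE; congr (_ * _ * _); rewrite mulrAC.
wlog kl : k l / (k <= l)%N.
  move=> H; case: (leqP k l) => [/H//|/ltnW/H[c cE]].
  by exists c => a b; rewrite -cE mulrAC.
have gP : in_Gamma ((i, j), (k, l)) by rewrite /in_Gamma ij kl.
exists [ffun g => if g == Sub ((i, j), (k, l)) gP then x else 0] => a b.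
rewrite /biquad_eval (bigD1 (Sub ((i, j), (k, l)) gP)) //= big1 ?addr0.
  by rewrite ffunE eqxx.
by move=> g /negPf gg; rewrite ffunE gg !mul0r.
Qed.

Lemma biquad_objP (n3 : nat) (Omega : {set 'I_n1 * 'I_n2 * 'I_n3})
    (A : 'I_n1 -> 'I_n2 -> 'I_n3 -> R) :
  exists c, forall a b, biquad_obj Omega A a b = biquad_eval c a b.
Proof.
rewrite -/(is_biquad _); apply: is_biquad_sum => k; apply: is_biquad_sum => s.
apply: is_biquad_sum => t.
case: (slice_nth s) => i j; case: (slice_nth t) => i' j'.
have [c cE] := is_biquadD (is_biquadD
  (is_biquad_monom (A i j k ^+ 2) i' i' j' j')
  (is_biquad_monom (A i' j' k ^+ 2) i i j j))
  (is_biquad_monom (- (A i j k * A i' j' k *+ 2)) i i' j j').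
exists c => a b; rewrite -cE; ring.
Qed.

(* The coefficients f_{ijkl}, unique by biquad_eval_inj. *)
Definition biquad_coef (n3 : nat) (Omega : {set 'I_n1 * 'I_n2 * 'I_n3})
    (A : 'I_n1 -> 'I_n2 -> 'I_n3 -> R) : {ffun Gamma -> R} :=
  sval (cid (biquad_objP Omega A)).

Definition gamma_pairing (c y : {ffun Gamma -> R}) : R :=
  \sum_(g : Gamma) c g * y g.

Definition Esym (n : nat) (i j : 'I_n) : 'M[R]_n :=
  if i == j then delta_mx i i else delta_mx i j + delta_mx j i.

Definition Gmx (y : {ffun Gamma -> R}) : 'M[R]_(n1 * n2) :=
  \sum_(g : Gamma) y g *: (Esym (gi g) (gj g) *t Esym (gk g) (gl g)).

End Biquadratic.

Section Problems.

Variables (R : realType) (n1 n2 n3 : nat).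
Variable Omega : {set 'I_n1 * 'I_n2 * 'I_n3}.
Variable A : 'I_n1 -> 'I_n2 -> 'I_n3 -> R.

Definition minimizer_P (a : 'cV[R]_n1) (b : 'cV[R]_n2) : Prop :=
  is_minimizer
    (fun p : 'cV[R]_n1 * 'cV[R]_n2 => enorm p.1 ^+ 2 = 1 /\ enorm p.2 ^+ 2 = 1)
    (fun p => biquad_obj Omega A p.1 p.2) (a, b).

Definition minimizer_R (y : {ffun Gamma n1 n2 -> R}) : Prop :=
  is_minimizer
    (fun z : {ffun Gamma n1 n2 -> R} => \tr (Gmx z) = 1 /\ psdmx (Gmx z))
    (gamma_pairing (biquad_coef Omega A)) y.

End Problems.

(* Main.v *)
Require Import Defs.
From mathcomp Require Import all_boot all_order all_algebra reals mxtens.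
From mathcomp Require Import boolp.

Import Order.TTheory GRing.Theory Num.Theory.
Local Open Scope ring_scope.

(** Every feasible pair (a, b) of the biquadratic problem yields a feasible
    point of the relaxation with the same objective value: its moment vector
    y_ijkl = a_i a_j b_k b_l, for which G[y] = (a a^T) (x) (b b^T) is positive
    semidefinite of trace |a|^2 |b|^2 (lemmas [Gmx_moment], [moment_feasible]
    and [pairing_moment]).  Hence the optimal value v of the relaxation is a
    lower bound of f on unit pairs.

    The map y |-> G[y] is linear and injective, because each y_ijkl occurs as
    an entry of G[y] ([Gmx_entry]).  The assumed decomposition of G[y*]
    therefore lifts to y* = sum_i lambda_i y^(i), with y^(i) the moment vector
    of (a^(i), b^(i)), and taking traces gives sum_i lambda_i = 1.  Pairing
    with f, v is a convex combination with positive weights of the values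
    f(a^(i), b^(i)), each of which is at least v; so all of them equal v, the
    lower bound ([convex_comb_min_eq]). *)

Definition sort_pair {n : nat} (i j : 'I_n) : 'I_n * 'I_n :=
  if (i <= j)%N then (i, j) else (j, i).

Lemma sort_pair_le {n : nat} (i j : 'I_n) :
  ((sort_pair i j).1 <= (sort_pair i j).2)%N.
Proof. by rewrite /sort_pair; case: (leqP i j) => //= /ltnW. Qed.

Lemma sort_pair_mul {R : comNzRingType} {n : nat} (u : 'I_n -> R) (i j : 'I_n) :
  u (sort_pair i j).1 * u (sort_pair i j).2 = u i * u j.
Proof. by rewrite /sort_pair; case: ifP => //= _; rewrite mulrC. Qed.

Lemma in_Gamma_sort {n1 n2 : nat} (i j : 'I_n1) (k l : 'I_n2) :
  in_Gamma (sort_pair i j, sort_pair k l).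
Proof. by rewrite /in_Gamma !sort_pair_le. Qed.

(** The label in Gamma of an arbitrary entry of G[y]: by symmetry of the E_ij
    the order inside (i, j) and inside (k, l) is immaterial. *)
Definition gamma_sort {n1 n2 : nat} (i j : 'I_n1) (k l : 'I_n2) : Gamma n1 n2 :=
  Sub (sort_pair i j, sort_pair k l) (in_Gamma_sort i j k l).

Lemma gamma_sortK {n1 n2 : nat} (g : Gamma n1 n2) :
  gamma_sort (gi g) (gj g) (gk g) (gl g) = g.
Proof.
apply: val_inj; rewrite /= /gi /gj /gk /gl /sort_pair.
by case: g => -[[i j] [k l]] /= /andP[/= -> ->].
Qed.

Lemma Esym_entry {R : realType} {n : nat} (p q i j : 'I_n) :
  (p <= q)%N -> Esym R p q i j = ((p, q) == sort_pair i j)%:R.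
Proof.
move=> pq; rewrite /Esym /sort_pair.
have [<-|npq] := eqVneq p q.
  rewrite mxE; case: ifP => _; rewrite xpair_eqE (eq_sym i) (eq_sym j) //.
  by rewrite andbC.
have {}pq : (p < q)%N by rewrite ltn_neqAle npq.
rewrite !mxE; case: (leqP i j) => ij; rewrite xpair_eqE ![_ == i]eq_sym ![_ == j]eq_sym.
- rewrite [X in _ + X](_ : _ = 0) ?addr0 //.
  case: (eqVneq i q) => //= iq; case: (eqVneq j p) => //= jp.
  by rewrite iq jp leqNgt pq in ij.
- rewrite [X in X + _](_ : _ = 0) ?add0r 1?andbC //.
  case: (eqVneq i p) => //= ip; case: (eqVneq j q) => //= jq.
  by rewrite ip jq ltnNge (ltnW pq) in ij.
Qed.

(** A symmetric matrix is the combination of the E_ij, i <= j, weighted by its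
    entries on and above the diagonal; applied to both tensor factors, this
    makes every entry of G[y] a single coordinate of y. *)
Lemma Gmx_entry {R : realType} {n1 n2 : nat} (y : {ffun Gamma n1 n2 -> R})
    (i j : 'I_n1) (k l : 'I_n2) :
  Gmx y (mxtens_index (i, k)) (mxtens_index (j, l)) = y (gamma_sort i j k l).
Proof.
rewrite /Gmx summxE (bigD1 (gamma_sort i j k l)) //= big1 ?addr0.
  rewrite mxE tensmxE !Esym_entry ?sort_pair_le //.
  by rewrite /gi /gj /gk /gl /= -!surjective_pairing !eqxx !mulr1.
move=> g /negPf neq_g; have /andP[gij gkl] : in_Gamma (val g) := valP g.
rewrite mxE tensmxE !Esym_entry // -natrM mulnb.
(* The two indicator conditions together say that g = gamma_sort i j k l. *)
rewrite -[X in X && _]/(((val g).1.1, (val g).1.2) == _).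
rewrite -[X in _ && X]/(((val g).2.1, (val g).2.2) == _).
rewrite -!surjective_pairing -xpair_eqE -surjective_pairing.
by rewrite -[_ == _]/(g == gamma_sort i j k l) neq_g mulr0.
Qed.

Lemma Gmx_inj {R : realType} {n1 n2 : nat} : injective (@Gmx R n1 n2).
Proof.
move=> y z yz; apply/ffunP => g.
by rewrite -(gamma_sortK g) -!Gmx_entry yz.
Qed.

Lemma Gmx_lincomb {R : realType} {n1 n2 r : nat} (lambda : 'I_r -> R)
    (z : 'I_r -> {ffun Gamma n1 n2 -> R}) :
  Gmx [ffun g => \sum_(i < r) lambda i * z i g] =
  \sum_(i < r) lambda i *: Gmx (z i).
Proof.
apply/matrixP => p q; rewrite -(mxtens_unindexK p) -(mxtens_unindexK q).
case: (mxtens_unindex p) (mxtens_unindex q) => i k [j l].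
rewrite Gmx_entry ffunE summxE; apply: eq_bigr => t _.
by rewrite mxE Gmx_entry.
Qed.

Definition moment {R : realType} {n1 n2 : nat} (a : 'cV[R]_n1) (b : 'cV[R]_n2) :
    {ffun Gamma n1 n2 -> R} :=
  [ffun g => a (gi g) 0 * a (gj g) 0 * (b (gk g) 0 * b (gl g) 0)].

Lemma Gmx_moment {R : realType} {n1 n2 : nat} (a : 'cV[R]_n1) (b : 'cV[R]_n2) :
  Gmx (moment a b) = (a *m a^T) *t (b *m b^T).
Proof.
apply/matrixP => p q; rewrite -(mxtens_unindexK p) -(mxtens_unindexK q).
case: (mxtens_unindex p) (mxtens_unindex q) => i k [j l].
rewrite Gmx_entry tensmxE ffunE !mxE !big_ord1 !mxE.
rewrite (sort_pair_mul (fun s => a s 0) i j).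
by rewrite (sort_pair_mul (fun s => b s 0) k l).
Qed.

Lemma pairing_moment {R : realType} {n1 n2 n3 : nat}
    (Omega : {set 'I_n1 * 'I_n2 * 'I_n3}) (A : 'I_n1 -> 'I_n2 -> 'I_n3 -> R)
    (a : 'cV[R]_n1) (b : 'cV[R]_n2) :
  gamma_pairing (biquad_coef Omega A) (moment a b) = biquad_obj Omega A a b.
Proof.
rewrite (svalP (cid (biquad_objP Omega A)) a b).
by apply: eq_bigr => g _; rewrite ffunE !mulrA.
Qed.

Lemma mxtrace_outer {R : realType} {n : nat} (a : 'cV[R]_n) :
  \tr (a *m a^T) = enorm a ^+ 2.
Proof.
rewrite sqr_sqrtr ?sumr_ge0 // => [|i _]; last exact: sqr_ge0.
by apply: eq_bigr => i _; rewrite mxE big_ord1 mxE expr2.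
Qed.

Lemma mxtrace_tens {R : comNzRingType} {m n : nat} (M : 'M[R]_m) (N : 'M[R]_n) :
  \tr (M *t N) = \tr M * \tr N.
Proof. by rewrite mulr_sum; apply: eq_bigr => i _; rewrite mxE. Qed.

Lemma mxtrace_Gmx_moment {R : realType} {n1 n2 : nat}
    (a : 'cV[R]_n1) (b : 'cV[R]_n2) :
  \tr (Gmx (moment a b)) = enorm a ^+ 2 * enorm b ^+ 2.
Proof.
by rewrite Gmx_moment -!mxtrace_outer mxtrace_tens.
Qed.

(** The mixed-product rule exhibits (a a^T) (x) (b b^T) as the rank-one matrix
    v v^T with v = a (x) b. *)
Lemma psd_Gmx_moment {R : realType} {n1 n2 : nat}
    (a : 'cV[R]_n1) (b : 'cV[R]_n2) : psdmx (Gmx (moment a b)).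
Proof.
rewrite Gmx_moment; split; first by rewrite trmx_tens !trmx_mul !trmxK.
move=> x; pose v : 'cV[R]_(n1 * n2) := a *t b.
have -> : (a *m a^T) *t (b *m b^T) = v *m v^T by rewrite -tensmx_mul -trmx_tens.
have -> : x^T *m (v *m v^T) *m x = (x^T *m v) *m (x^T *m v)^T.
  by rewrite trmx_mul trmxK !mulmxA.
by rewrite mxE big_ord1 [X in _ * X]mxE -expr2 sqr_ge0.
Qed.

Lemma moment_feasible {R : realType} {n1 n2 : nat}
    (a : 'cV[R]_n1) (b : 'cV[R]_n2) :
  enorm a ^+ 2 = 1 -> enorm b ^+ 2 = 1 ->
  \tr (Gmx (moment a b)) = 1 /\ psdmx (Gmx (moment a b)).
Proof.
move=> a1 b1; split; last exact: psd_Gmx_moment.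
by rewrite mxtrace_Gmx_moment a1 b1 mulr1.
Qed.

(** The weighted excesses lambda_i (w_i - v) are nonnegative and sum to zero,
    hence all vanish. *)
Lemma convex_comb_min_eq {R : realType} {r : nat} (lambda w : 'I_r -> R) (v : R) :
  (forall i, 0 < lambda i) -> \sum_(i < r) lambda i = 1 ->
  (forall i, v <= w i) -> \sum_(i < r) lambda i * w i = v ->
  forall i, w i = v.
Proof.
move=> lambda_gt0 lambda1 vw sumw i.
have excess_ge0 j : true -> 0 <= lambda j * (w j - v).
  by rewrite mulr_ge0 ?subr_ge0 // ltW.
have /eqP : \sum_(j < r) lambda j * (w j - v) = 0.
  under eq_bigr do rewrite mulrBr.
  by rewrite sumrB -mulr_suml sumw lambda1 mul1r subrr.
rewrite psumr_eq0 // => /allP/(_ i (mem_index_enum i)) /=.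
by rewrite mulf_eq0 gt_eqF //= subr_eq0 => /eqP.
Qed.

Theorem theorem4p3 (R : realType) (n1 n2 n3 : nat)
    (hn1 : (0 < n1)%N) (hn2 : (0 < n2)%N) (hn3 : (0 < n3)%N)
    (Omega : {set 'I_n1 * 'I_n2 * 'I_n3})
    (A : 'I_n1 -> 'I_n2 -> 'I_n3 -> R)
    (y : {ffun Gamma n1 n2 -> R})
    (hy : minimizer_R Omega A y)
    (r : nat) (a : 'I_r -> 'cV[R]_n1) (b : 'I_r -> 'cV[R]_n2)
    (lambda : 'I_r -> R)
    (ha : forall i, enorm (a i) = 1) (hb : forall i, enorm (b i) = 1)
    (hlambda : forall i, 0 < lambda i)
    (hG : Gmx y =
      \sum_(i < r) lambda i *: ((a i *m (a i)^T) *t (b i *m (b i)^T))) :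
  forall i : 'I_r, minimizer_P Omega A (a i) (b i).
Proof.
have [[tr_y _] y_min] := hy.
have a1 i : enorm (a i) ^+ 2 = 1 by rewrite ha expr1n.
have b1 i : enorm (b i) ^+ 2 = 1 by rewrite hb expr1n.
have lower_bound a' b' : enorm a' ^+ 2 = 1 -> enorm b' ^+ 2 = 1 ->
    gamma_pairing (biquad_coef Omega A) y <= biquad_obj Omega A a' b'.
  move=> a'1 b'1; rewrite -pairing_moment.
  exact/y_min/moment_feasible.
have y_moments : y = [ffun g => \sum_(i < r) lambda i * moment (a i) (b i) g].
  apply: Gmx_inj; rewrite hG Gmx_lincomb.
  by apply: eq_bigr => i _; rewrite Gmx_moment.
have lambda1 : \sum_(i < r) lambda i = 1.
  rewrite -tr_y y_moments Gmx_lincomb raddf_sum; apply: eq_bigr => i _.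
  by rewrite /= mxtraceZ mxtrace_Gmx_moment a1 b1 !mulr1.
have value_y : \sum_(i < r) lambda i * biquad_obj Omega A (a i) (b i) =
    gamma_pairing (biquad_coef Omega A) y.
  rewrite y_moments /gamma_pairing.
  under [RHS]eq_bigr => g _ do rewrite ffunE mulr_sumr.
  rewrite exchange_big; apply: eq_bigr => i _ /=.
  rewrite -pairing_moment mulr_sumr.
  by apply: eq_bigr => g _; rewrite mulrCA.
move=> i; split=> [|[a' b'] /= [a'1 b'1]]; first (split; [exact: a1 | exact: b1]).
rewrite (convex_comb_min_eq _ _ _ hlambda lambda1 _ value_y); last first.
  by move=> j; apply: lower_bound.
exact: lower_bound.
Qed.
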